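(* Let $X$ be an Archimedean vector lattice, $\tau$ a locally solid topology on $X$, and $A$ an (order) ideal of $X$. Then $u_A\tau$ is Riesz submetrizable if and only if $\tau$ is Riesz submetrizable and there is a set in $A$ (i.e. a subset of $A$) that is a countable order basis for $X$.
   Context: All vector lattices are assumed Archimedean. A linear topology on a vector lattice is locally solid if it has a base at zero consisting of solid sets; it is not assumed Hausdorff unless stated. A locally solid topology is Riesz submetrizable if it is finer than (or equal to) a metrizable locally solid topology. If $A$ is an ideal of $X$ and $\{U_i\}$ is a base at zero of solid sets for $\tau$, then $u_A\tau$, the unbounded topology on $X$ induced by $A$, is the locally solid topology on $X$ with base at zero consisting of the sets $U_{i,a}=\{x\in X:\ |x|\wedge a\in U_i\}$, over all $i$ and all $a\in A_+$. An at most countable set $C\subseteq X$ is a countable order basis for $X$ if $B(C)=X$, where $B(C)$ is the band generated by $C$ in $X$. *)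

(* Defs.v *)
From HB Require Import structures.
From mathcomp Require Import all_boot all_order all_algebra.
From mathcomp Require Import all_classical all_reals all_analysis.

Set Implicit Arguments.
Unset Strict Implicit.
Unset Printing Implicit Defensive.

Import Order.TTheory GRing.Theory Num.Theory.
Import numFieldNormedType.Exports.

Local Open Scope classical_set_scope.
Local Open Scope ring_scope.

(* Order.Lattice cannot be a parent here: Num.RealDomain, declared earlier,
   already inherits from both Order.Lattice and GRing.Zmodule, so HB would
   require the join of the two to have been declared first. The lattice
   operations therefore sit in the mixin, with the laws of
   Order.POrder_isMeetSemilattice and Order.POrder_isJoinSemilattice, and the
   latticeType instance is derived below; use Order.meet and Order.join. *)
HB.mixin Record isVectorLattice (R : numDomainType) X
    & Num.POrderedZmodule X & GRing.Lmodule R X := {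
  vmeet : X -> X -> X ;
  vjoin : X -> X -> X ;
  lexI_subproof : forall x y z : X, (x <= vmeet y z) = (x <= y) && (x <= z) ;
  leUx_subproof : forall x y z : X, (vjoin x y <= z) = (x <= z) && (y <= z) ;
  vlerD2r_subproof : forall z x y : X, x <= y -> x + z <= y + z ;
  vscaler_ge0_subproof : forall (a : R) (x : X), 0 <= a -> 0 <= x -> 0 <= a *: x
}.

#[short(type="vectorLatticeType")]
HB.structure Definition VectorLattice (R : numDomainType) :=
  { X of Num.POrderedZmodule X & GRing.Lmodule R X & isVectorLattice R X }.

Section VectorLatticeIsLattice.
Variables (R : numDomainType) (X : vectorLatticeType R).
HB.instance Definition _ :=
  Order.POrder_isMeetSemilattice.Build ring_display X (@lexI_subproof R X).
HB.instance Definition _ :=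
  Order.POrder_isJoinSemilattice.Build ring_display X (@leUx_subproof R X).
End VectorLatticeIsLattice.

Section VectorLatticeNotions.
Variables (R : realType) (X : vectorLatticeType R).
Implicit Types (A B C D : set X).

Definition vabs (x : X) : X := Order.join x (- x).

Definition archimedean :=
  forall x y : X, 0 <= x -> (forall n : nat, x *+ n <= y) -> x = 0.

Definition solid A := forall x y : X, A y -> vabs x <= vabs y -> A x.

Definition is_ideal A :=
  [/\ A 0, forall x y, A x -> A y -> A (x + y),
      forall (t : R) x, A x -> A (t *: x) & solid A].

Definition is_band B :=
  is_ideal B /\ forall D, D `<=` B -> supremums D `<=` B.

Definition generated_band C := smallest is_band C.

Definition countable_order_basis C :=
  countable C /\ generated_band C = setT.

End VectorLatticeNotions.
Arguments archimedean {R} X.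

(* Several topologies on the same space have to be compared, so they are terms
   rather than canonical structures; [with_topology tau] is X seen as a
   topologicalType with open sets [opens tau]. *)
Record topology (T : Type) := Topology {
  opens : set_system T ;
  opensT : opens setT ;
  opensI : setI_closed opens ;
  opens_bigU : forall (I : Type) (f : I -> set T), (forall i, opens (f i)) ->
    opens (\bigcup_i f i)
}.

Definition with_topology (R : realType) (X : vectorLatticeType R)
  (tau : topology X) : Type := X.

Section WithTopology.
Variables (R : realType) (X : vectorLatticeType R) (tau : topology X).
HB.instance Definition _ := VectorLattice.on (with_topology tau).
HB.instance Definition _ := isOpenTopological.Build (with_topology tau)
  (opensT tau) (@opensI _ tau) (@opens_bigU _ tau).
End WithTopology.

Section Topologies.
Variables (R : realType) (X : vectorLatticeType R).
Implicit Types (tau sigma : topology X) (A : set X) (B : set_system X).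

Definition finer tau sigma := opens sigma `<=` opens tau.

Definition linear_topology tau :=
  continuous (fun p : with_topology tau * with_topology tau => p.1 + p.2) /\
  continuous (fun p : R^o * with_topology tau => p.1 *: p.2).

(* the members of B are neighborhoods of zero, not necessarily open *)
Definition base_at_zero tau B :=
  nbhs (0 : with_topology tau) = filter_from B id.

Definition solid_base_at_zero tau B :=
  base_at_zero tau B /\ forall U, B U -> solid U.

Definition locally_solid tau :=
  linear_topology tau /\ exists B, solid_base_at_zero tau B.

Definition metrizable tau :=
  exists (M : metricType R) (f : with_topology tau -> M)
         (g : M -> with_topology tau),
    [/\ cancel f g, cancel g f, continuous f & continuous g].

Definition riesz_submetrizable tau :=
  exists sigma, [/\ locally_solid sigma, metrizable sigma & finer tau sigma].

End Topologies.

Section VectorLatticeTheory.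
Variables (R : realType) (X : vectorLatticeType R).
Implicit Types (x y z u v a : X).

Lemma vlerD2r z x y : x <= y -> x + z <= y + z.
Proof. exact: vlerD2r_subproof. Qed.

Lemma vlerD x y u v : x <= y -> u <= v -> x + u <= y + v.
Proof.
move=> xy uv; apply: le_trans (vlerD2r u xy) _.
by rewrite (addrC y) (addrC y); exact: vlerD2r.
Qed.

Lemma vlerBlDr x y z : (x - y <= z) = (x <= z + y).
Proof.
by apply/idP/idP => [/(vlerD2r y)|/(vlerD2r (- y))]; rewrite ?subrK ?addrK.
Qed.

Lemma vsubr_ge0 x y : (0 <= y - x) = (x <= y).
Proof.
by apply/idP/idP => [/(vlerD2r x)|/(vlerD2r (- x))]; rewrite ?subrK ?add0r ?subrr.
Qed.

Lemma vscale_ge0 (t : R) x : 0 <= t -> 0 <= x -> 0 <= t *: x.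
Proof. exact: vscaler_ge0_subproof. Qed.

Lemma vler_scale (t : R) x y : 0 <= t -> x <= y -> t *: x <= t *: y.
Proof.
by move=> t0 xy; rewrite -vsubr_ge0 -scalerBr vscale_ge0// vsubr_ge0.
Qed.

Lemma vler_scaler (s t : R) x : s <= t -> 0 <= x -> s *: x <= t *: x.
Proof.
by move=> st x0; rewrite -vsubr_ge0 -scalerBl vscale_ge0// subr_ge0.
Qed.

Lemma vabs_le x y : (vabs x <= y) = (x <= y) && (- x <= y).
Proof. exact: leUx. Qed.

Lemma vabs_geid x : x <= vabs x. Proof. exact: leUl. Qed.

Lemma vabs_geN x : - x <= vabs x. Proof. exact: leUr. Qed.

Lemma vabsN x : vabs (- x) = vabs x.
Proof. by rewrite /vabs opprK joinC. Qed.

Lemma vabs_ge0 x : 0 <= vabs x.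
Proof.
have : 0 <= vabs x + vabs x.
  by rewrite -[leLHS](subrr x) vlerD ?vabs_geid ?vabs_geN.
have h0 : 0 <= 2^-1 :> R by rewrite invr_ge0.
move=> /(vscale_ge0 h0).
by rewrite -mulr2n -(scaler_nat 2 (vabs x)) scalerA mulVf ?pnatr_eq0// scale1r.
Qed.

Lemma vabs_id x : 0 <= x -> vabs x = x.
Proof.
move=> x0; apply/eqP; rewrite eq_le vabs_geid andbT vabs_le lexx/=.
by rewrite (le_trans _ x0)// -[leLHS]add0r vlerBlDr add0r.
Qed.

Lemma vabs0 : vabs (0 : X) = 0. Proof. exact: vabs_id. Qed.

Lemma vabsD x y : vabs (x + y) <= vabs x + vabs y.
Proof. by rewrite vabs_le opprD !vlerD ?vabs_geid ?vabs_geN. Qed.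

Lemma vabsZ_le (t : R) x : vabs (t *: x) <= `|t| *: vabs x.
Proof.
rewrite vabs_le; apply/andP; have [t0|t0] := ger0P t; split.
- by apply: vler_scale => //; exact: vabs_geid.
- by rewrite -scalerN; apply: vler_scale => //; exact: vabs_geN.
- by rewrite -[t *: x]opprK -scaleNr -scalerN; apply: vler_scale;
    [rewrite oppr_ge0 ltW|exact: vabs_geN].
- by rewrite -scaleNr; apply: vler_scale;
    [rewrite oppr_ge0 ltW|exact: vabs_geid].
Qed.

Lemma vmeet_ge0 x y : 0 <= x -> 0 <= y -> 0 <= Order.meet x y.
Proof. by rewrite lexI => -> ->. Qed.

Lemma vmeetD u v a : 0 <= u -> 0 <= v -> 0 <= a ->
  Order.meet (u + v) a <= Order.meet u a + Order.meet v a.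
Proof.
move=> u0 v0 a0; set w := Order.meet (u + v) a.
have wa : w <= a by exact: leIr.
rewrite -vlerBlDr lexI; apply/andP; split; rewrite vlerBlDr; last first.
  by rewrite (le_trans wa)// -[leLHS]addr0 vlerD// vmeet_ge0.
rewrite [leRHS]addrC -vlerBlDr lexI; apply/andP; split; rewrite vlerBlDr.
  by rewrite addrC; exact: leIl.
by rewrite (le_trans wa)// -[leLHS]addr0 vlerD.
Qed.

Lemma vmeetZ (t : R) u a : 1 <= t -> 0 <= a ->
  Order.meet (t *: u) a <= t *: Order.meet u a.
Proof.
move=> t1 a0; have t0 : 0 < t by exact: lt_le_trans t1.
set w := Order.meet _ _.
suff : t^-1 *: w <= Order.meet u a.
  move=> /(vler_scale (ltW t0)); rewrite scalerA mulfV ?gt_eqF//.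
  by rewrite scale1r.
rewrite lexI; have tV0 : 0 <= t^-1 by rewrite invr_ge0 ltW.
apply/andP; split.
  have /(vler_scale tV0) : w <= t *: u by exact: leIl.
  by rewrite scalerA mulVf ?gt_eqF// scale1r.
have /(vler_scale tV0) : w <= t *: a.
  rewrite (le_trans (leIr _ _))// -[leLHS]scale1r vler_scaler//.
by rewrite scalerA mulVf ?gt_eqF// scale1r.
Qed.

Lemma vmeet_mono u v a : u <= v -> Order.meet u a <= Order.meet v a.
Proof. by move=> uv; rewrite leI2. Qed.

Lemma solid_ge0 (U : set X) x y : solid U -> 0 <= x -> x <= y -> U y -> U x.
Proof.
move=> sU x0 xy Uy; apply: (sU _ _ Uy).
by rewrite !vabs_id// (le_trans x0).
Qed.

Lemma solidI (U V : set X) : solid U -> solid V -> solid (U `&` V).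
Proof. by move=> sU sV x y [Uy Vy] xy; split; [exact: sU xy|exact: sV xy]. Qed.

Lemma ideal_join (A : set X) a b : is_ideal A -> A a -> A b -> 0 <= a -> 0 <= b ->
  A (Order.join a b).
Proof.
case=> A0 AD AZ sA Aa Ab a0 b0; apply: solid_ge0 (AD _ _ Aa Ab) => //.
  by rewrite (le_trans a0) ?leUl.
rewrite leUx; apply/andP; split.
  by rewrite -[leLHS]addr0 vlerD.
by rewrite -[leLHS]add0r vlerD.
Qed.

End VectorLatticeTheory.

Section Unbounded.
Variables (R : realType) (X : vectorLatticeType R).
Implicit Types (tau : topology X) (A U V : set X).

Definition unbounded_ball U (a : X) : set X :=
  [set x | U (Order.meet (vabs x) a)].

(* V is open iff around each of its points it contains a translate of some
   U_{i,a}; since all solid bases at zero give the same topology, U ranges over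
   all solid neighborhoods of zero (see [unbounded_base_at_zero]) *)
Definition unbounded_opens A tau : set_system X :=
  [set V | forall x, V x -> exists U a,
    [/\ nbhs (0 : with_topology tau) U, solid U, A a, 0 <= a &
        forall y, unbounded_ball U a (y - x) -> V y]].

Section Def.
Variables (A : set X) (idealA : is_ideal A) (tau : topology X).

Fact unbounded_opensT : unbounded_opens A tau setT.
Proof.
move=> x _; exists setT, 0; split=> //; first exact: filterT.
by case: idealA.
Qed.

Fact unbounded_opensI : setI_closed (unbounded_opens A tau).
Proof.
move=> V W oV oW x [/oV[U [a [U0 sU Aa a0 UV]]] /oW[U' [b [U0' sU' Ab b0 UW]]]].
exists (U `&` U'), (Order.join a b); split.
- exact: filterI.
- exact: solidI.
- exact: ideal_join.
- by rewrite (le_trans a0) ?leUl.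
- move=> y [Uy Uy']; split; [apply: UV|apply: UW].
  + apply: solid_ge0 Uy => //; rewrite ?vmeet_ge0 ?vabs_ge0//.
    by rewrite leI2 ?leUl.
  + apply: solid_ge0 Uy' => //; rewrite ?vmeet_ge0 ?vabs_ge0//.
    by rewrite leI2 ?leUr.
Qed.

Fact unbounded_opens_bigU (I : Type) (f : I -> set X) :
  (forall i, unbounded_opens A tau (f i)) ->
  unbounded_opens A tau (\bigcup_i f i).
Proof.
move=> oF x [i _ /oF[U [a [U0 sU Aa a0 UV]]]].
by exists U, a; split=> // y /UV; exists i.
Qed.

Definition unbounded_topology : topology X :=
  Topology unbounded_opensT unbounded_opensI unbounded_opens_bigU.

End Def.
End Unbounded.

Section UnboundedTheory.
Variables (R : realType) (X : vectorLatticeType R) (tau : topology X).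
Variables (A : set X) (idealA : is_ideal A).
Hypothesis lstau : locally_solid tau.
Local Notation T := (with_topology tau).
Local Notation S := (with_topology (unbounded_topology idealA tau)).

Lemma solid_nbhs0 (V : set X) : nbhs (0 : T) V ->
  exists U, [/\ nbhs (0 : T) U, solid U & U `<=` V].
Proof.
case: lstau => _ [B [B0 sB]]; rewrite B0 => -[U BU UV].
by exists U; split=> //; [exists U|exact: sB].
Qed.

Lemma half_nbhs0 (V : set X) : nbhs (0 : T) V ->
  exists U, [/\ nbhs (0 : T) U, solid U & forall x y, U x -> U y -> V (x + y)].
Proof.
case: lstau => -[addc _] _ V0.
have := addc (0, 0) V; rewrite /= addr0 => /(_ V0) [[P Q]] /= [P0 Q0] PQ.
have [U [U0 sU UPQ]] := solid_nbhs0 (filterI P0 Q0).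
exists U; split=> // x y /UPQ[Px _] /UPQ[_ Qy].
exact: (PQ (x, y)).
Qed.

Lemma scale_nbhs0 (t : R) (V : set X) : nbhs (0 : T) V ->
  exists U, [/\ nbhs (0 : T) U, solid U & forall x, U x -> V (t *: x)].
Proof.
case: lstau => -[_ scalec] _ V0.
have := scalec (t, 0) V; rewrite /= scaler0 => /(_ V0) [[P Q]] /= [P0 Q0] PQ.
have [U [U0 sU UQ]] := solid_nbhs0 Q0.
by exists U; split=> // x /UQ Qx; apply: (PQ (t, x)); split=> //=; apply: nbhs_singleton.
Qed.

Lemma absorb_nbhs0 (x : X) (V : set X) : nbhs (0 : T) V ->
  \forall t \near (0 : R), V (t *: x).
Proof.
case: lstau => -[_ scalec] _ V0.
have := scalec (0, x) V; rewrite /= scale0r => /(_ V0) [[P Q]] /= [P0 Q0] PQ.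
apply: filterS P0 => t Pt; apply: (PQ (t, x)); split=> //=.
exact: nbhs_singleton Q0.
Qed.

Lemma unbounded_ballS (U : set X) (a x y : X) : solid U -> 0 <= a ->
  vabs x <= vabs y -> unbounded_ball U a y -> unbounded_ball U a x.
Proof.
move=> sU a0 xy Uy; apply: (solid_ge0 sU _ _ Uy); last exact: vmeet_mono.
by rewrite vmeet_ge0 ?vabs_ge0.
Qed.

Lemma unbounded_ballD (U V : set X) (a x y : X) : solid V -> 0 <= a ->
  (forall x y, U x -> U y -> V (x + y)) ->
  unbounded_ball U a x -> unbounded_ball U a y -> unbounded_ball V a (x + y).
Proof.
move=> sV a0 UV Ux Uy; apply: solid_ge0 (UV _ _ Ux Uy) => //.
  by rewrite vmeet_ge0 ?vabs_ge0.
rewrite (le_trans (vmeet_mono _ (vabsD _ _)))//.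
by rewrite vmeetD ?vabs_ge0.
Qed.

Lemma nbhs_unbounded (x : X) (V : set X) :
  nbhs (x : S) V <-> exists U a,
    [/\ nbhs (0 : T) U, solid U, A a, 0 <= a &
        forall y, unbounded_ball U a (y - x) -> V y].
Proof.
split=> [[W [oW Wx WV]]|[U [a [U0 sU Aa a0 UV]]]].
  have [U [a [U0 sU Aa a0 UW]]] := oW x Wx.
  by exists U, a; split=> // y /UW /WV.
exists [set z | exists U a, [/\ nbhs (0 : T) U, solid U, A a, 0 <= a &
        forall y, unbounded_ball U a (y - z) -> V y]]; split.
- move=> z [U1 [b [U10 sU1 Ab b0 UV1]]].
  have [W [W0 sW WU]] := half_nbhs0 U10.
  exists W, b; split=> // y Wy; exists W, b; split=> // y' Wy'.
  apply: UV1; rewrite -(subrK y y') -addrA.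
  exact: unbounded_ballD Wy' Wy.
- by exists U, a.
- move=> z [U1 [b [U10 sU1 Ab b0 UV1]]]; apply: UV1.
  rewrite /unbounded_ball/= subrr vabs0.
  have -> : Order.meet (0 : X) b = 0 by apply/meet_idPl.
  exact: nbhs_singleton U10.
Qed.

(* u_A tau has the base of the definition, whatever the solid base B of tau *)
Lemma unbounded_base_at_zero (B : set_system X) : solid_base_at_zero tau B ->
  base_at_zero (unbounded_topology idealA tau)
    [set V | exists U a, [/\ B U, A a, 0 <= a & V = unbounded_ball U a]].
Proof.
move=> [B0 sB]; apply/seteqP; split=> V; rewrite nbhs_unbounded.
- move=> [U [a [U0 sU Aa a0 UV]]].
  move: U0; rewrite B0 => -[W BW WU].
  exists (unbounded_ball W a); first by exists W, a.
  by move=> x /WU Ux; apply: UV; rewrite /unbounded_ball/= subr0.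
- move=> [_ [U [a [BU Aa a0 ->]]] UV]; exists U, a; split=> //.
  + by rewrite B0; exists U.
  + exact: sB.
  + by move=> y; rewrite subr0 => /UV.
Qed.

Lemma unbounded_locally_solid : locally_solid (unbounded_topology idealA tau).
Proof.
split; [split|].
- move=> [x y] V /= /nbhs_unbounded[U [a [U0 sU Aa a0 UV]]].
  have [W [W0 sW WU]] := half_nbhs0 U0.
  exists ([set z | unbounded_ball W a (z - x)],
          [set z | unbounded_ball W a (z - y)]) => /=.
    by split; apply/nbhs_unbounded; exists W, a.
  move=> [x' y'] /= [Wx Wy]; apply: UV.
  by rewrite opprD addrACA; exact: unbounded_ballD Wx Wy.
- move=> [t x] V /= /nbhs_unbounded[U [a [U0 sU Aa a0 UV]]].
  have [W [W0 sW WU]] := half_nbhs0 U0.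
  have c1 : 1 <= `|t| + 1 by rewrite lerDr.
  have [W' [W'0 sW' WW']] := scale_nbhs0 (`|t| + 1) W0.
  exists ([set s | `|s - t| < 1 /\ W ((s - t) *: x)],
          [set z | unbounded_ball W' a (z - x)]) => /=.
    split; last by apply/nbhs_unbounded; exists W', a.
    apply: filterI.
      by apply/nbhs_ballP; exists 1 => //= s; rewrite /ball/= distrC.
    have : (fun s : R => s - t) @ t --> (0 : R).
      rewrite -[X in _ --> X](subrr t); apply: cvgB; [exact: cvg_id|exact: cvg_cst].
    by move=> /(_ _ (absorb_nbhs0 x W0)).
  move=> [s z] /= [[st Wst] Wz]; apply: UV.
  have -> : s *: z - t *: x = s *: (z - x) + (s - t) *: x.
    by rewrite scalerBr scalerBl addrA subrK.
  apply: (unbounded_ballD sU a0 WU).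
    apply: (solid_ge0 sW _ _ (WW' _ Wz)).
      by rewrite vmeet_ge0 ?vabs_ge0.
    apply: le_trans (vmeetZ _ c1 a0); apply: vmeet_mono.
    apply: le_trans (vabsZ_le _ _) _; apply: vler_scaler; last exact: vabs_ge0.
    by rewrite -(subrK t s) addrC (le_trans (ler_normD _ _))// lerD2l ltW.
  apply: (solid_ge0 sW _ (leIl _ _)).
    by rewrite vmeet_ge0 ?vabs_ge0.
  by apply: sW Wst _; rewrite [vabs (vabs _)]vabs_id ?vabs_ge0.
- have [B sB] : exists B, solid_base_at_zero tau B by case: lstau.
  eexists; split; first exact: (unbounded_base_at_zero sB).
  move=> _ [U [a [BU Aa a0 ->]]] x y Uy xy.
  by apply: unbounded_ballS Uy => //; case: sB => _; apply.
Qed.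

End UnboundedTheory.

(* Main.v *)
Require Import Defs.
From HB Require Import structures.
From mathcomp Require Import all_boot all_order all_algebra.
From mathcomp Require Import all_classical all_reals all_analysis.

(** Write u_A tau for the unbounded topology that the ideal A induces.

    If u_A tau is finer than a metrizable locally solid sigma, so is tau, as
    |x| /\ a <= |x| makes tau finer than u_A tau. Each member V of a countable
    base of sigma at zero is a u_A tau neighborhood of zero, so it contains some
    {x : |x| /\ a_V in U_V} with a_V in A_+. A vector disjoint from all the a_V
    then lies in every V, hence is zero because sigma is Hausdorff, and in an
    Archimedean space a set with trivial disjoint complement generates the
    whole space as a band ([generated_bandT]).

    Conversely, let sigma be metrizable, locally solid and coarser than tau, and
    let the sequence f in A enumerate a countable order basis. The ideal I
    generated by f lies in A, so u_I sigma is coarser than u_A tau, and it is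
    locally solid like every unbounded topology. It has a countable base at
    zero, because I is exhausted by the order intervals of one increasing
    sequence ([unbounded_countably_based]). It is Hausdorff, because the vectors
    disjoint from a given vector form a band ([disjoint_complement_band]), so
    that only zero is disjoint from the whole order basis
    ([unbounded_separated], [generated_bandT_disjoint]). Finally, a locally
    solid topology is induced by a uniformity, hence is metrizable as soon as it
    is Hausdorff with a countable base at zero
    ([countable_base_metrizable]). *)

Set Implicit Arguments.
Unset Strict Implicit.
Unset Printing Implicit Defensive.

Import Order.TTheory GRing.Theory Num.Theory.
Import numFieldNormedType.Exports.

Local Open Scope classical_set_scope.
Local Open Scope ring_scope.

(** * Disjointness and bands *)

Section Disjointness.
Variables (R : realType) (X : vectorLatticeType R).
Implicit Types (x y z u v a c : X) (B C : set X).

Definition disjoint x y := Order.meet (vabs x) (vabs y) = 0.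

Lemma vabs_eq0 x : vabs x = 0 -> x = 0.
Proof.
move=> x0; apply/eqP; rewrite eq_le -{1}x0 vabs_geid/=.
by rewrite -vsubr_ge0 subr0 -[x]opprK -[- - x]add0r vsubr_ge0 -x0 vabs_geN.
Qed.

Lemma vsubr_le_id x y : x <= x - y -> y <= 0.
Proof.
by move=> /(vlerD2r (y - x)); rewrite addrC subrK addrA subrK subrr.
Qed.

Lemma vmeet_eq0 u v : 0 <= u -> 0 <= v -> Order.meet u v <= 0 ->
  Order.meet u v = 0.
Proof. by move=> u0 v0 uv; apply/eqP; rewrite eq_le uv vmeet_ge0. Qed.

Lemma disjointxx x : disjoint x x -> x = 0.
Proof. by rewrite /disjoint meetxx => /vabs_eq0. Qed.

Lemma disjoint_solid x y c : disjoint y c -> vabs x <= vabs y -> disjoint x c.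
Proof.
move=> yc xy; apply: vmeet_eq0; rewrite ?vabs_ge0//.
by rewrite -yc; exact: vmeet_mono.
Qed.

Lemma disjointD x y c : disjoint x c -> disjoint y c -> disjoint (x + y) c.
Proof.
move=> xc yc; apply: vmeet_eq0; rewrite ?vabs_ge0//.
apply: le_trans (vmeet_mono _ (vabsD x y)) _.
by rewrite (le_trans (vmeetD _ _ _)) ?vabs_ge0// xc yc addr0.
Qed.

Lemma disjointZ (t : R) x c : disjoint x c -> disjoint (t *: x) c.
Proof.
move=> xc; apply: vmeet_eq0; rewrite ?vabs_ge0//.
have t1 : 1 <= `|t| + 1 by rewrite lerDr.
have tx : vabs (t *: x) <= (`|t| + 1) *: vabs x.
  apply: le_trans (vabsZ_le _ _) _; apply: vler_scaler; last exact: vabs_ge0.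
  by rewrite lerDl.
apply: le_trans (vmeet_mono _ tx) _.
by rewrite (le_trans (vmeetZ _ t1 _)) ?vabs_ge0// xc scaler0.
Qed.

(** For disjoint u and v, the sum u + v is their supremum. *)
Lemma disjoint_add_le u v w :
  Order.meet u v = 0 -> u <= w -> v <= w -> u + v <= w.
Proof.
move=> uv uw vw; rewrite -[leRHS]add0r -uv -vlerBlDr lexI !vlerBlDr.
by rewrite vlerD//= addrC vlerD.
Qed.

(** Closure under a supremum s of D is the point. The part v of the positive
    part p of s that lies below |c| is disjoint from every member of D, so p - v
    still bounds D; hence p <= p - v and v = 0. The negative part of s is
    controlled by any single member of D. *)
Lemma disjoint_complement_band c : is_band [set x | disjoint x c].
Proof.
split; first split.
- by rewrite /= /disjoint vabs0; apply/meet_idPl; exact: vabs_ge0.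
- by move=> x y; exact: disjointD.
- by move=> t x; exact: disjointZ.
- by move=> x y /= yc xy; exact: disjoint_solid xy.
move=> D Dc s [Ds sD] /=.
(* a supremum of the empty set is a least element, so the space is trivial *)
have [[d Dd]|D0] := pselect (D !=set0); last first.
  have c0 : vabs c <= 0.
    have : s <= s - vabs c by apply: sD => x Dx; case: D0; exists x.
    exact: vsubr_le_id.
  by apply: vmeet_eq0; rewrite ?vabs_ge0// (le_trans (leIr _ _)).
pose p := Order.join s 0; have p0 : 0 <= p by exact: leUr.
pose v := Order.meet p (vabs c).
have v0 : 0 <= v by rewrite vmeet_ge0 ?vabs_ge0.
have v_le0 : v <= 0.
  suff : p <= p - v by exact: vsubr_le_id.
  rewrite {1}/p leUx vsubr_ge0 leIl andbT; apply: sD => e De.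
  apply: (@le_trans _ _ (Order.join e 0)); first exact: leUl.
  rewrite -vsubr_ge0 -addrA -opprD vsubr_ge0 addrC.
  apply: disjoint_add_le.
  - apply: vmeet_eq0; rewrite ?leUr//.
    apply: (@le_trans _ _ (Order.meet (vabs e) (vabs c))).
      by apply: leI2; [rewrite leUx vabs_geid vabs_ge0|exact: leIr].
    by rewrite (Dc _ De).
  - by rewrite leUx leUr andbT (le_trans (Ds _ De))// leUl.
  - exact: leIl.
apply: vmeet_eq0; rewrite ?vabs_ge0//.
apply: (@le_trans _ _ (Order.meet (p + vabs d) (vabs c))).
  apply: vmeet_mono; rewrite vabs_le; apply/andP; split.
    by rewrite -[leLHS]addr0 vlerD ?vabs_ge0// leUl.
  rewrite -[leLHS]add0r vlerD// (le_trans _ (vabs_geN d))//.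
  by rewrite -vsubr_ge0 opprK addrC vsubr_ge0 Ds.
rewrite (le_trans (vmeetD _ _ _)) ?vabs_ge0//.
by rewrite (Dc _ Dd) addr0.
Qed.

(** The vectors disjoint from c form a band that contains C, so c itself is one
    of them. *)
Lemma generated_bandT_disjoint C c : generated_band C = setT ->
  (forall x, C x -> disjoint x c) -> c = 0.
Proof.
move=> CT Cc; have : generated_band C c by rewrite CT.
by move=> /(_ _ (conj (disjoint_complement_band c) Cc))/disjointxx.
Qed.

(** Every y >= 0 is the supremum of the members d of the band with
    0 <= d <= y. For an upper bound z of these, let w = y - (z /\ y). Its meet v
    with |c|, for a generator c, lies in the band and can be added to any such d
    without exceeding y; all multiples of v are then below y, so v = 0. Hence w
    is disjoint from C, that is, y <= z. *)
Lemma generated_bandT C : archimedean X ->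
  (forall x, (forall c, C c -> disjoint x c) -> x = 0) ->
  generated_band C = setT.
Proof.
move=> archX Cd; apply/seteqP; split=> // x _ B [bandB CB].
have [[B0 BD BZ sB] supB] := bandB.
suff pos y : 0 <= y -> B y.
  by apply: (sB _ _ (pos _ (vabs_ge0 x))); rewrite [leRHS]vabs_id ?vabs_ge0.
move=> y0; pose D := [set d | [/\ B d, 0 <= d & d <= y]].
apply: (supB D) => [d []//|]; split=> [d []//|z Dz].
pose w := y - Order.meet z y.
have w0 : 0 <= w by rewrite vsubr_ge0 leIr.
have D_le d : D d -> d <= Order.meet z y.
  by move=> Dd; rewrite lexI (Dz _ Dd); case: Dd.
have : w = 0.
  apply: Cd => c Cc; apply: (archX _ y); first by rewrite vmeet_ge0 ?vabs_ge0.
  move=> n; set v := Order.meet _ _.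
  have v0 : 0 <= v by rewrite vmeet_ge0 ?vabs_ge0.
  have Bv : B v.
    by apply: sB (CB _ Cc) _; rewrite vabs_id//; exact: leIr.
  suff : D (v *+ n) by case.
  elim: n => [|n IH]; first by split.
  have [Bn n0 _] := IH; split.
  - by rewrite mulrS; exact: BD.
  - by rewrite mulrS -[leLHS]addr0 vlerD.
  - rewrite mulrSr -[leRHS](subrK (Order.meet z y)) addrC.
    apply: vlerD; last exact: D_le.
    by rewrite (le_trans (leIl _ _))// vabs_id.
by move=> /subr0_eq ->; exact: leIl.
Qed.
End Disjointness.

(** * Metrization of locally solid topologies *)

Section ZeroNeighborhoods.
Variables (R : realType) (X : vectorLatticeType R) (tau : topology X).

Definition countably_based :=
  exists2 B : set_system X, countable B & base_at_zero tau B.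

Definition separated_at_zero :=
  forall x : with_topology tau,
    (forall V, nbhs (0 : with_topology tau) V -> V x) -> x = 0.

End ZeroNeighborhoods.

(** A separated uniform space with a countable base is pseudometrizable with all
    distances bounded; the infimum of the radii of the balls around x that
    contain y is then a finite distance, which vanishes only for x = y. *)
Section UniformMetrization.
Variables (R : realType) (U : uniformType).
Hypothesis countU : countable_uniformity U.
Hypothesis separatedU :
  forall x y : U, (forall E, entourage E -> E (x, y)) -> x = y.
Local Notation P := (countable_uniform countU : pseudoMetricType R).

Let dist (x y : U) : R := fine (edist ((x, y) : P * P)).

Let edist_fin_num (x y : P) : edist (x, y) \is a fin_num.
Proof.
apply/edist_finP; exists 2 => //=.
exact: countable_uniform.countable_uniform_bounded.
Qed.

Let distE (x y : P) : (dist x y)%:E = edist (x, y).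
Proof. by rewrite fineK. Qed.

Let distxx x : dist x x = 0.
Proof.
by apply/EFin_inj; rewrite distE; exact/edist_closeP.
Qed.

Let dist_positivity x y : dist x y = 0 -> x = y.
Proof.
move=> xy0; apply: separatedU => E.
move=> entE; have : @entourage P E by [].
rewrite -entourage_ballE => -[e /= e0]; apply => /=.
have : (edist ((x, y) : P * P) < e%:E)%E by rewrite -distE xy0 lte_fin.
by move=> /edist_lt_ball.
Qed.

Let dist_sym x y : dist x y = dist y x.
Proof. by rewrite /dist edist_sym. Qed.

Let dist_triangle y x z : dist x z <= dist x y + dist y z.
Proof. by rewrite -lee_fin EFinD !distE edist_triangle. Qed.

(** The carrier under a new name, so that its topology is the one of the metric;
    the bindings keep the data of the metric as parameters. *)
Definition metrized : Type :=
  let _ := countU in let _ := separatedU in let _ := R in U.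

HB.instance Definition _ := Choice.copy metrized U.
HB.instance Definition _ := @isMetric.Build R metrized
  dist distxx dist_positivity dist_sym dist_triangle.

(** The open balls of the distance are squeezed between the balls of the
    pseudometric of radii e / 2 and e. *)
Lemma nbhs_metrized (x : U) : nbhs (x : metrized) = nbhs x.
Proof.
apply/seteqP; split=> V.
  move=> /nbhs_ballP[e /= e0 eV]; apply/(@nbhs_ballP R P).
  exists (e / 2) => /=; first by rewrite divr_gt0.
  move=> y xy; apply: eV; rewrite ballEmdist /=.
  have: (edist ((x, y) : P * P) <= (e / 2)%:E)%E.
    by apply: edist_fin; rewrite ?divr_gt0.
  rewrite -distE lee_fin => /le_lt_trans; apply.
  by rewrite ltr_pdivrMr// ltr_pMr// ltr1n.
move=> /(@nbhs_ballP R P)[e /= e0 eV]; apply/nbhs_ballP; exists e => //= y.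
rewrite ballEmdist /= -lte_fin => xy; apply: eV.
by move: xy; rewrite (distE x y); exact: edist_lt_ball.
Qed.

End UniformMetrization.

Section LocallySolidUniformity.
Variables (R : realType) (X : vectorLatticeType R) (tau : topology X).
Hypothesis lstau : locally_solid tau.
Local Notation T := (with_topology tau).

Let nbhs_addr (x y : T) V : nbhs (y + x) V -> nbhs y [set z : T | V (z + x)].
Proof.
case: lstau => -[addc _] _ /(addc (y, x))[[P Q]] /= [Py Qx] PQ.
apply: filterS Py => z Pz; apply: (PQ (z, x)); split=> //.
exact: nbhs_singleton Qx.
Qed.

(** Translations are homeomorphisms, so that the neighborhoods of zero determine
    the topology. *)
Lemma nbhs_translate (x : T) V :
  nbhs x V <-> nbhs (0 : T) [set z : T | V (z + x)].
Proof.
split=> [xV|]; first by apply: nbhs_addr; rewrite add0r.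
move=> V0; have := @nbhs_addr (- x) x [set z : T | V (z + x)].
rewrite subrr => /(_ V0); congr (nbhs x _).
by apply/seteqP; split=> z /=; rewrite subrK.
Qed.

Definition translation_entourage : set_system (T * T) := fun E =>
  exists2 U, nbhs (0 : T) U & forall x y, U (y - x) -> E (x, y).

Let ent_filter : Filter translation_entourage.
Proof.
split.
- by exists setT => //; exact: filterT.
- move=> E F [U U0 UE] [V V0 VF]; exists (U `&` V); first exact: filterI.
  by move=> x y [/UE ? /VF].
- by move=> E F EF [U U0 UE]; exists U => // x y /UE /EF.
Qed.

Let ent_diagonal E : translation_entourage E -> diagonal `<=` E.
Proof.
move=> [U U0 UE] [x y] /= /diagonalP ->; apply: UE.
by rewrite subrr; exact: nbhs_singleton U0.
Qed.

Let ent_inv E : translation_entourage E -> translation_entourage E^-1%relation.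
Proof.
move=> [V V0 VE]; have [U [U0 sU UV]] := solid_nbhs0 lstau V0.
exists U => // x y Uyx; apply: VE; apply: UV; apply: sU Uyx _.
by rewrite -vabsN opprB.
Qed.

Let ent_split E : translation_entourage E ->
  exists2 F, translation_entourage F & (F \; F)%relation `<=` E.
Proof.
move=> [V V0 VE]; have [U [U0 sU UV]] := half_nbhs0 lstau V0.
exists [set p | U (p.2 - p.1)]; first by exists U.
move=> [x z] [y /= xy yz]; apply: VE.
by rewrite -(subrK y z) -addrA; exact: UV.
Qed.

Let nbhs_ent : nbhs = nbhs_ translation_entourage.
Proof.
apply/funext => x; rewrite nbhs_E; apply/seteqP; split=> V.
  move=> /nbhs_translate V0.
  exists [set p | V (p.2 - p.1 + x)]; first by exists [set z | V (z + x)].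
  by move=> y /xsectionP /=; rewrite subrK.
move=> [E [U U0 UE] EV]; apply/nbhs_translate.
apply: filterS U0 => z Uz; apply: EV; apply/xsectionP; apply: UE.
by rewrite addrK.
Qed.

(** The space with the uniformity of its additive group; solidity provides the
    symmetric neighborhoods, and it induces the original topology. *)
Definition translation_uniform : Type := let _ := lstau in T.

HB.instance Definition _ := Topological.copy translation_uniform T.
HB.instance Definition _ := Nbhs_isUniform_mixin.Build translation_uniform
  ent_filter ent_diagonal ent_inv ent_split nbhs_ent.

Lemma countable_base_metrizable :
  countably_based tau -> separated_at_zero tau -> metrizable tau.
Proof.
move=> [B cB B0] sep.
have cU : countable_uniformity translation_uniform.
  exists ((fun V => [set p | V (p.2 - p.1)]) @` B); split.
  - exact: (sub_countable (card_image_le _ _) cB).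
  - by move=> _ [V BV <-]; exists V => //; rewrite B0; exists V.
  - move=> E [U]; rewrite B0 => -[V BV VU] UE.
    exists [set p | V (p.2 - p.1)]; first by exists V.
    by move=> [x y] /= /VU; exact: UE.
have sU : forall x y : translation_uniform,
    (forall E, entourage E -> E (x, y)) -> x = y.
  move=> x y xy; apply/esym/subr0_eq/(sep (y - x)) => V V0.
  by apply: (xy [set p | V (p.2 - p.1)]); exists V.
exists (metrized R cU sU : metricType R), id, id; split=> //.
- by move=> x V; rewrite nbhs_metrized.
- move=> x V Vx.
  by rewrite -[nbhs _]/(nbhs (x : metrized R cU sU)) nbhs_metrized.
Qed.
End LocallySolidUniformity.

(** * Comparison of topologies *)

Section TopologyComparison.
Variables (R : realType) (X : vectorLatticeType R).
Implicit Types (tau sigma : topology X) (A I : set X).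

Lemma nbhs_finer tau sigma (x : X) (V : set X) : finer tau sigma ->
  nbhs (x : with_topology sigma) V -> nbhs (x : with_topology tau) V.
Proof. by move=> ts [W [oW Wx WV]]; exists W; split=> //; exact: ts. Qed.

Lemma finer_trans tau1 tau2 tau3 :
  finer tau1 tau2 -> finer tau2 tau3 -> finer tau1 tau3.
Proof. by move=> t12 t23 V /t23 /t12. Qed.

(** A solid U is contained in every {x : |x| /\ a in U}. *)
Lemma unbounded_finer tau A (idealA : is_ideal A) : locally_solid tau ->
  finer tau (unbounded_topology idealA tau).
Proof.
move=> lstau V oV.
suff : @open (with_topology tau) V by [].
rewrite openE => x /oV[U [a [U0 sU Aa a0 UV]]].
apply/(nbhs_translate lstau); apply: filterS U0 => z Uz; apply: UV.
rewrite addrK; apply: (solid_ge0 sU _ (leIl _ _)).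
  by rewrite vmeet_ge0 ?vabs_ge0.
by apply: sU Uz _; rewrite [vabs (vabs _)]vabs_id ?vabs_ge0.
Qed.

Lemma unbounded_mono tau sigma A I (idealA : is_ideal A) (idealI : is_ideal I) :
  I `<=` A -> finer tau sigma ->
  finer (unbounded_topology idealA tau) (unbounded_topology idealI sigma).
Proof.
move=> IA ts V oV x /oV[U [a [U0 sU Ia a0 UV]]].
by exists U, a; split=> //; [exact: nbhs_finer U0|exact: IA].
Qed.

Lemma metrizable_countably_based tau : metrizable tau -> countably_based tau.
Proof.
move=> [M [f [g [fK gK cf cg]]]].
pose V n : set (with_topology tau) := f @^-1` ball (f 0) n.+1%:R^-1.
have V0 n : nbhs (0 : with_topology tau) (V n).
  by apply: cf; apply: nbhsx_ballx; rewrite invr_gt0.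
exists (range V); first exact: card_image_le.
apply/seteqP; split=> W; last first.
  by move=> [_ [n _ <-]] VW; apply: filterS (V0 n).
rewrite -[X in nbhs X]fK => /cg /nbhs_ballP[e /= e0 eW].
exists (V (Num.truncn e^-1)); first by exists (Num.truncn e^-1).
move=> x Vx; rewrite -[x]fK; apply: eW.
apply: le_ball Vx; rewrite -[leRHS]invrK lef_pV2 ?posrE ?invr_gt0//.
by rewrite ltW// truncnS_gt.
Qed.

Lemma metrizable_separated tau : metrizable tau -> separated_at_zero tau.
Proof.
move=> [M [f [g [fK gK cf cg]]]] x x0; rewrite -[x]fK -[RHS]fK; congr g.
apply/eqP/negPn/negP; rewrite eq_sym -mdist_gt0 => d0.
have := x0 _ (cf 0 _ (nbhsx_ballx (f 0) _ d0)).
by rewrite /= ballEmdist /= ltxx.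
Qed.

End TopologyComparison.

(** * Countable bases and separation for unbounded topologies *)

Section UnboundedMetrizable.
Variables (R : realType) (X : vectorLatticeType R) (tau : topology X).
Variables (A : set X) (idealA : is_ideal A).
Hypothesis lstau : locally_solid tau.

(** A sequence g cofinal in A_+ suffices: if a <= g n and U is solid, then
    |x| /\ g n in U forces |x| /\ a in U. *)
Lemma unbounded_countably_based (g : nat -> X) :
  (forall n, A (g n)) -> (forall n, 0 <= g n) ->
  (forall a, A a -> exists n, a <= g n) ->
  countably_based tau -> countably_based (unbounded_topology idealA tau).
Proof.
move=> Ag g0 Ale [B cB B0].
exists ((fun p => unbounded_ball p.1 (g p.2)) @` (B `*` setT)).
  by apply: (sub_countable (card_image_le _ _)); exact: countableX.
apply/seteqP; split=> V; rewrite (nbhs_unbounded idealA lstau).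
  move=> [U [a [U0 sU Aa a0 UV]]]; move: U0; rewrite B0 => -[W BW WU].
  have [n an] := Ale _ Aa.
  exists (unbounded_ball W (g n)); first by exists (W, n).
  move=> x /WU Ux; apply: UV; rewrite subr0.
  apply: solid_ge0 Ux => //; first by rewrite vmeet_ge0 ?vabs_ge0.
  by rewrite leI2.
move=> [_ [[W n] [BW _] <-]] /= WV.
have /(solid_nbhs0 lstau)[U [U0 sU UW]] : nbhs (0 : with_topology tau) W.
  by rewrite B0; exists W.
by exists U, (g n); split=> // y; rewrite subr0 => Uy; apply: WV; exact: UW.
Qed.

(** If x lies in all unbounded neighborhoods of zero, then for each a in A the
    vector |x| /\ |a| lies in all neighborhoods of zero of tau. *)
Lemma unbounded_separated :
  (forall x, (forall a, A a -> disjoint a x) -> x = 0) ->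
  separated_at_zero tau -> separated_at_zero (unbounded_topology idealA tau).
Proof.
move=> Ad sep x x0; apply: Ad => a Aa.
apply: sep => W /(solid_nbhs0 lstau)[U [U0 sU]]; apply.
rewrite meetC; apply: (x0 (unbounded_ball U (vabs a))).
apply/(nbhs_unbounded idealA lstau).
exists U, (vabs a); split=> //; last by move=> y; rewrite subr0.
  case: idealA => _ _ _ sA; apply: sA Aa _.
  by rewrite vabs_id ?vabs_ge0.
exact: vabs_ge0.
Qed.

End UnboundedMetrizable.

(** * The ideal generated by a sequence *)

Section SequenceIdeal.
Variables (R : realType) (X : vectorLatticeType R) (f : nat -> X).

(** A single index bounds both the number of terms and their multiplicity, so
    that one sequence is cofinal in the positive cone of the ideal generated by
    f. *)
Definition dominating_seq n := (\sum_(k < n) vabs (f k)) *+ n.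

Definition seq_ideal : set X := [set x | exists n, vabs x <= dominating_seq n].

Let partial_sum_ge0 n : 0 <= \sum_(k < n) vabs (f k).
Proof.
elim: n => [|n IH]; first by rewrite big_ord0.
by rewrite big_ord_recr /= -[leLHS]addr0 vlerD ?vabs_ge0.
Qed.

Let partial_sum_le m n : (m <= n)%N ->
  \sum_(k < m) vabs (f k) <= \sum_(k < n) vabs (f k).
Proof.
move=> /subnKC <-; rewrite big_split_ord /= -[leLHS]addr0 vlerD//.
elim: (n - m)%N => [|p IH]; first by rewrite big_ord0.
by rewrite big_ord_recr /= -[leLHS]addr0 vlerD ?vabs_ge0.
Qed.

Let vler_muln n (x y : X) : x <= y -> x *+ n <= y *+ n.
Proof.
by move=> xy; elim: n => // n IH; rewrite !mulrS vlerD.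
Qed.

Lemma dominating_seq_ge0 n : 0 <= dominating_seq n.
Proof. by rewrite -[leLHS](mul0rn _ n); exact/vler_muln/partial_sum_ge0. Qed.

(** This makes [seq_ideal] closed under addition, hence under integer multiples
    and, by solidity, under scaling. *)
Lemma dominating_seqD m n :
  dominating_seq m + dominating_seq n <= dominating_seq (m + n).
Proof.
rewrite /dominating_seq mulrnDr vlerD// vler_muln// partial_sum_le//.
  exact: leq_addr.
exact: leq_addl.
Qed.

Lemma dominating_seq_ge k : vabs (f k) <= dominating_seq k.+1.
Proof.
rewrite /dominating_seq mulrS -[leLHS]addr0; apply: vlerD.
  by rewrite big_ord_recr /= -[leLHS]add0r vlerD ?partial_sum_ge0.
by rewrite -[leLHS](mul0rn _ k); exact/vler_muln/partial_sum_ge0.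
Qed.

Lemma seq_ideal_ideal : is_ideal seq_ideal.
Proof.
have I0 : seq_ideal 0 by exists 0%N; rewrite vabs0 dominating_seq_ge0.
have ID x y : seq_ideal x -> seq_ideal y -> seq_ideal (x + y).
  move=> [m xm] [n yn]; exists (m + n)%N; apply: le_trans (vabsD _ _) _.
  by apply: le_trans (dominating_seqD _ _); exact: vlerD.
have sI : solid seq_ideal.
  by move=> x y [n yn] xy; exists n; exact: le_trans yn.
have In n x : seq_ideal x -> seq_ideal (x *+ n).
  by move=> Ix; elim: n => // n IH; rewrite mulrS; exact: ID.
split=> // t x Ix; pose n := (Num.truncn `|t|).+1.
apply: sI (In n _ (sI (vabs x) _ Ix _)) _.
  by rewrite vabs_id ?vabs_ge0.
rewrite -[vabs x *+ n]scaler_nat [leRHS]vabs_id ?vscale_ge0 ?vabs_ge0//.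
apply: le_trans (vabsZ_le _ _) _; apply: vler_scaler; last exact: vabs_ge0.
by rewrite ltW// truncnS_gt.
Qed.

Lemma seq_ideal_sub (A : set X) : is_ideal A -> (forall k, A (f k)) ->
  seq_ideal `<=` A.
Proof.
move=> [A0 AD AZ sA] Af x [n xn]; apply: (sA _ (dominating_seq n)); last first.
  by rewrite [leRHS]vabs_id ?dominating_seq_ge0.
rewrite /dominating_seq -scaler_nat; apply: AZ.
elim/big_ind : _ => // k _; apply: sA (Af k) _.
by rewrite vabs_id ?vabs_ge0.
Qed.

Lemma seq_ideal_dominating n : seq_ideal (dominating_seq n).
Proof. by exists n; rewrite vabs_id ?dominating_seq_ge0. Qed.

Lemma seq_ideal_mem k : seq_ideal (f k).
Proof. by exists k.+1; exact: dominating_seq_ge. Qed.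

Lemma seq_ideal_bounded x : seq_ideal x -> exists n, x <= dominating_seq n.
Proof. by move=> [n xn]; exists n; exact: le_trans (vabs_geid x) _. Qed.

End SequenceIdeal.

(** An empty C has no enumeration of its own; the values may therefore leave C
    while staying in A. *)
Lemma countable_sub_range (T : Type) (C A : set T) (x0 : T) : countable C ->
  C `<=` A -> A x0 ->
  exists f : nat -> T, (forall n, A (f n)) /\ C `<=` range f.
Proof.
move=> /pfcard_geP[->|/unsquash f] CA Ax0; first last.
  exists f; split=> [n|x /(@surj _ _ _ _ f)[n _ <-]]; last by exists n.
  by apply: CA; exact: funS.
by exists (fun=> x0); split=> //; exact: sub0set.
Qed.

(** * Riesz submetrizability of unbounded topologies *)

Theorem corollary2p4 (R : realType) (X : vectorLatticeType R)
    (archX : archimedean X) (tau : topology X) (lstau : locally_solid tau)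
    (A : set X) (idealA : is_ideal A) :
  riesz_submetrizable (unbounded_topology idealA tau) <->
  riesz_submetrizable tau /\
  exists C : set X, C `<=` A /\ countable_order_basis C.
Proof.
split.
  move=> [sigma [lssigma msigma Asigma]]; split.
    exists sigma; split=> //.
    by apply: finer_trans Asigma; exact: unbounded_finer.
  have [B cB B0] := metrizable_countably_based msigma.
  have sep := metrizable_separated msigma.
  have /choice[a aP] (V : set X) : exists a, [/\ A a, 0 <= a & B V ->
      exists2 U, nbhs (0 : with_topology tau) U & unbounded_ball U a `<=` V].
    have [BV|] := pselect (B V); last first.
      by move=> nBV; exists 0; split=> //; have [] := idealA.
    have : nbhs (0 : with_topology sigma) V by rewrite B0; exists V.
    move=> /(nbhs_finer Asigma) /(nbhs_unbounded idealA lstau).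
    move=> [U [a [U0 _ Aa a0 UV]]]; exists a; split=> // _; exists U => // x Ux.
    by apply: UV; rewrite subr0.
  exists (a @` B); split; first by move=> _ [V _ <-]; case: (aP V).
  split; first exact: (sub_countable (card_image_le _ _) cB).
  apply: generated_bandT => // x xC; apply: sep => W; rewrite B0 => -[V BV].
  apply; have [_ a0 /(_ BV)[U U0]] := aP V; apply; rewrite /unbounded_ball /=.
  have /xC : (a @` B) (a V) by exists V.
  rewrite /disjoint (vabs_id a0) meetC => ->; exact: nbhs_singleton U0.
move=> [[sigma [lssigma msigma tausigma]] [C [CA [cC CT]]]].
have A0 : A 0 by case: idealA.
have [f [Af Cf]] := countable_sub_range cC CA A0.
have idealI := seq_ideal_ideal f.
(* f takes its values in A, so the unbounded topology of its ideal is coarser *)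
exists (unbounded_topology idealI sigma); split.
- exact: unbounded_locally_solid.
- apply: countable_base_metrizable; first exact: unbounded_locally_solid.
    apply: (@unbounded_countably_based _ _ _ _ _ _ (dominating_seq f)) => //.
    + exact: seq_ideal_dominating.
    + exact: dominating_seq_ge0.
    + exact: seq_ideal_bounded.
    + exact: metrizable_countably_based.
  apply: unbounded_separated (metrizable_separated msigma) => //.
  move=> x Ix; apply: (generated_bandT_disjoint CT) => c /Cf[k _ <-].
  exact/Ix/seq_ideal_mem.
- by apply: unbounded_mono => //; exact: seq_ideal_sub.
Qed.
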